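(* For every digraph $D$ of order $n$, $dac(D)\leq \frac{n+\omega(D)}{2}$.
   Context: All digraphs are finite, loopless, and simple: $D=(V,A)$ where $A$ is a set of ordered pairs $uv$ (darts) of distinct vertices; both $uv$ and $vu$ may be darts. A clique is a set of vertices such that for any two distinct $u,v$ in it both $uv$ and $vu$ are darts; $\omega(D)$ is the maximum size of a clique. A coloring of $D$ with $k$ colors is a surjective map $\varsigma:V\to\{1,\dots,k\}$; it is acyclic if each color class induces a subdigraph with no directed cycle, and complete if for every ordered pair of distinct colors $(i,j)$ there is a dart $uv$ with $\varsigma(u)=i$ and $\varsigma(v)=j$. The diachromatic number $dac(D)$ is the largest $k$ for which $D$ has a complete acyclic coloring with $k$ colors. *)

(* Defs.v *)
From mathcomp Require Import all_boot.
Set Implicit Arguments. Unset Strict Implicit. Unset Printing Implicit Defensive.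

(* Finite, loopless, simple digraphs: opposite darts are
   allowed, and [dart] being a relation rules out parallel darts. *)
Record digraph := Digraph {
  vertex :> finType;
  dart : rel vertex;
  dart_irr : irreflexive dart }.

Section Digraph.
Variable D : digraph.

Definition clique (K : {set D}) : bool :=
  [forall u in K, forall v in K, (u != v) ==> dart u v && dart v u].

Definition omega : nat := \max_(K : {set D} | clique K) #|K|.

(* A directed cycle is given by its sequence of distinct vertices in cyclic
   order.  Its length is at least 2 because there are no loops; a pair of
   opposite darts counts as a directed cycle. *)
Definition dicycle (p : seq D) : bool :=
  [&& p != [::], uniq p & cycle (@dart D) p].

(* The subdigraph induced by S has no directed cycle.  Bounding the length by
   #|D| only serves to make the quantifier finite; see [acyclicP]. *)
Definition acyclic (S : {set D}) : bool :=
  [forall p : {bseq #|D| of D}, ~~ (dicycle p && all [in S] p)].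

Lemma acyclicP (S : {set D}) :
  reflect (forall p : seq D, dicycle p -> ~ {subset p <= S}) (acyclic S).
Proof.
apply: (iffP forallP) => [H p cp pS | H p].
  have sz : size p <= #|D|.
    by case/and3P: cp => _ /card_uniqP <- _; apply: max_card.
  by have := H (Bseq sz); rewrite cp /=; case: allP.
by apply/andP => -[cp /allP]; apply: H.
Qed.

Section Coloring.
Variables (k : nat) (c : {ffun D -> 'I_k}).

Definition surjective_coloring : bool := [forall i, exists v, c v == i].

Definition acyclic_coloring : bool :=
  [forall i : 'I_k, acyclic [set v | c v == i]].

Definition complete_coloring : bool :=
  [forall i : 'I_k, forall j : 'I_k, (i != j) ==>
     [exists u, exists v, [&& dart u v, c u == i & c v == j]]].

End Coloring.

Definition complete_acyclic_colorable (k : nat) : bool :=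
  [exists c : {ffun D -> 'I_k},
     [&& surjective_coloring c, acyclic_coloring c & complete_coloring c]].

(* Surjectivity forces k <= #|D|, so the range of the maximum is no
   restriction; see [dac_max].  Some k always qualifies: an acyclic coloring
   with the fewest colors is complete, as merging two colors with no dart
   from one to the other keeps the coloring acyclic. *)
Definition dac : nat :=
  \max_(k < #|D|.+1 | complete_acyclic_colorable k) k.

Lemma dac_max (k : nat) : complete_acyclic_colorable k -> k <= dac.
Proof.
move=> Hk; have lek : k < #|D|.+1.
  case/existsP: Hk => c /and3P[/forallP sc _ _].
  rewrite ltnS -[k]card_ord -(card_codom (f := fun i => xchoose (existsP (sc i)))).
    exact: max_card.
  by move=> i j E; rewrite -(eqP (xchooseP (existsP (sc i)))) E;
     apply/eqP/(xchooseP (existsP (sc j))).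
exact: (@leq_bigmax_cond _ (fun i : 'I_#|D|.+1 => complete_acyclic_colorable i)
         (fun i => i : nat) (Ordinal lek)).
Qed.

End Digraph.

(* Main.v *)
Require Import Defs.
From mathcomp Require Import all_boot all_order all_algebra.
Import Order.TTheory GRing.Theory Num.Theory.
Local Open Scope ring_scope.

(** In a complete coloring with [k] colors, the vertices that are alone in their
    color class form a clique [K], and every other class has at least two
    vertices; hence [2k <= n + #|K| <= n + omega]. *)

Lemma card_fibers {T I : finType} (f : T -> I) (A : {set T}) :
  #|A| = (\sum_i #|[set v in A | f v == i]|)%N.
Proof.
rewrite -sum1_card (partition_big f xpredT) //=.
by apply: eq_bigr => i _; rewrite -sum1_card; apply: eq_bigl => v; rewrite inE.
Qed.

Definition lone_vertices {D : digraph} {k : nat} (c : {ffun D -> 'I_k}) :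
  {set D} := [set v | #|[set u | c u == c v]| == 1%N].

Lemma lone_vertices_eq {D : digraph} {k : nat} {c : {ffun D -> 'I_k}} {u v : D} :
  v \in lone_vertices c -> c u = c v -> u = v.
Proof.
rewrite inE => /cards1P[w Ew] cuv.
have: u \in [set w] by rewrite -Ew inE cuv.
have: v \in [set w] by rewrite -Ew inE.
by rewrite !inE => /eqP -> /eqP ->.
Qed.

(** Completeness gives a dart from the class of [u] to the class of [v]; when both classes are
    singletons, its ends can only be [u] and [v]. *)
Lemma clique_lone_vertices (D : digraph) (k : nat) (c : {ffun D -> 'I_k}) :
  complete_coloring c -> clique (lone_vertices c).
Proof.
move=> /forallP cc.
have dartK (u v : D) : u \in lone_vertices c -> v \in lone_vertices c ->
    u != v -> dart u v.
  move=> uK vK uv.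
  have cuv : c u != c v by apply: contraNneq uv => /(lone_vertices_eq vK) ->.
  have /forallP/(_ (c v)) := cc (c u).
  move=> /implyP/(_ cuv)/existsP[x /existsP[y /and3P[xy /eqP cx /eqP cy]]].
  by rewrite -(lone_vertices_eq uK cx) -(lone_vertices_eq vK cy).
apply/forall_inP => u uK; apply/forall_inP => v vK; apply/implyP => uv.
by rewrite !dartK // eq_sym.
Qed.

(** Split both cardinals on the right by color: each nonempty class contributes its size plus the
    number of lone vertices in it, which is at least 2. *)
Lemma double_colors_le {D : digraph} {k : nat} {c : {ffun D -> 'I_k}} :
  surjective_coloring c -> (k.*2 <= #|D| + #|lone_vertices c|)%N.
Proof.
move=> /forallP sc.
rewrite -cardsT (card_fibers c [set: D]) (card_fibers c (lone_vertices c)).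
rewrite -big_split /= -[in leqLHS](card_ord k) -muln2 -sum_nat_const.
apply: leq_sum => i _; have /existsP[v /eqP cv] := sc i.
have -> : [set u in [set: D] | c u == i] = [set u | c u == i].
  by apply/setP => u; rewrite !inE.
have fib_gt0 : (0 < #|[set u | c u == i]|)%N.
  by apply/card_gt0P; exists v; rewrite inE cv.
case: (ltngtP #|[set u | c u == i]| 1) fib_gt0 => [||fib1 _].
- by rewrite ltnS leqNgt => /negP.
- by move=> fib_gt1 _; apply: leq_trans fib_gt1 (leq_addr _ _).
(* The only vertex of a singleton class is lone, so it is counted in both summands. *)
- rewrite fib1 add1n ltnS; apply/card_gt0P; exists v.
  by rewrite !inE cv fib1 !eqxx.
Qed.

Lemma double_dac_le (D : digraph) : ((dac D).*2 <= #|D| + omega D)%N.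
Proof.
(* Halving the right side leaves the maximum bare on the left, so it suffices to bound each
   admissible [k]. *)
rewrite -geq_half_double; apply/bigmax_leqP => k /existsP[c /and3P[sc _ cc]].
rewrite geq_half_double; apply: leq_trans (double_colors_le sc) _.
rewrite leq_add2l /omega; apply: leq_bigmax_cond.
exact: clique_lone_vertices.
Qed.

Theorem theorem4 (D : digraph) :
  (dac D)%:R <= (#|D|%:R + (omega D)%:R) / 2%:R :> rat.
Proof.
by rewrite ler_pdivlMr // -natrM -natrD ler_nat muln2 double_dac_le.
Qed.
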